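(* Let $S$ be a finite subset of $\mathbb{H}^2$ that is not contained in a single line. Then there exists a line $\ell$ in $\mathbb{H}^2$ such that $2\leq |S\cap\ell|\leq 24$.
   Context: $\mathbb{H}$ denotes the quaternions. $\mathbb{H}^2$ is regarded as a left vector space over $\mathbb{H}$. A line in $\mathbb{H}^2$ is a set of the form $\{p+\lambda v:\lambda\in\mathbb{H}\}$ with $p,v\in\mathbb{H}^2$, $v\neq 0$, where $\lambda v$ denotes left scalar multiplication. Equivalently, lines are the sets $\{(x,y):x=c\}$ for $c\in\mathbb{H}$ and the sets $\{(x,y): y=xm+c\}$ for $m,c\in\mathbb{H}$. *)

(* Defs.v *)
From HB Require Import structures.
From mathcomp Require Import all_boot all_order all_algebra finmap.
From mathcomp Require Import boolp reals.
Set Implicit Arguments. Unset Strict Implicit. Unset Printing Implicit Defensive.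
Import Order.TTheory GRing.Theory Num.Theory.
Local Open Scope ring_scope.

Definition quat (R : realType) : Type := (R * R * R * R)%type.

Section Quat.
Variable R : realType.
Definition qre (q : quat R) : R := q.1.1.1.
Definition qi (q : quat R) : R := q.1.1.2.
Definition qj (q : quat R) : R := q.1.2.
Definition qk (q : quat R) : R := q.2.

Definition qzero : quat R := (0, 0, 0, 0).
Definition qadd (p q : quat R) : quat R :=
  (qre p + qre q, qi p + qi q, qj p + qj q, qk p + qk q).
(* Hamilton product: i^2 = j^2 = k^2 = ijk = -1 *)
Definition qmul (p q : quat R) : quat R :=
  (qre p * qre q - qi p * qi q - qj p * qj q - qk p * qk q,
   qre p * qi q + qi p * qre q + qj p * qk q - qk p * qj q,
   qre p * qj q - qi p * qk q + qj p * qre q + qk p * qi q,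
   qre p * qk q + qi p * qj q - qj p * qi q + qk p * qre q).

Definition pt : Type := (quat R * quat R)%type.
Definition ptadd (p q : pt) : pt := (qadd p.1 q.1, qadd p.2 q.2).
Definition ptscale (l : quat R) (v : pt) : pt := (qmul l v.1, qmul l v.2).
Definition ptzero : pt := (qzero, qzero).

Definition on_line (p v : pt) (x : pt) : Prop :=
  exists l : quat R, x = ptadd p (ptscale l v).
Definition is_line (L : pt -> Prop) : Prop :=
  exists p v : pt, v <> ptzero /\ forall x, L x <-> on_line p v x.
End Quat.

(* Main.v *)
(* A linear map T of H^3 turns the points of S, in homogeneous coordinates, into
   unit vectors u_i = T p_i / |T p_i|.  The energy is the sum over all pairs of
   |<u_i, u_j>|^2, the squared norm of the sum of the rank one matrices
   u_i^* u_i.  Suppose that every line through two of the n points holds k >= 25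
   of them.
   - The vectors of one line span a 2-dimensional space, so Cauchy-Schwarz gives
     them energy at least k^2 / 2; adding over the lines, the whole energy is at
     least (23/48) n^2.
   - For T in nearly isotropic position the energy is close to n^2 / 3.  Such a T
     is a near-minimiser of 3 sum_i log |T p_i|^2 - 2 n log det T over triangular
     T: if a coordinate or a correlation carried too much energy, a scaling or a
     shear would decrease this potential by a definite amount.  The potential is
     bounded below by Hadamard's inequality, because no line holds more than half
     of the points. *)
Require Import Defs.
From HB Require Import structures.
From mathcomp Require Import all_boot all_order all_algebra finmap.
From mathcomp Require Import boolp reals.
From mathcomp Require Import classical_sets exp ring lra.
Import Order.TTheory GRing.Theory Num.Theory.

Section QuaternionPlane.
Local Open Scope ring_scope.
Set Implicit Arguments. Unset Strict Implicit.
Variable R : realType.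
Implicit Types (x y z : quat R) (t : R).

(** * Quaternion arithmetic, norms and shears *)

Definition qconj x : quat R := (qre x, - qi x, - qj x, - qk x).
Definition qscale t x : quat R := (t * qre x, t * qi x, t * qj x, t * qk x).
Definition qdot x y : R :=
  qre x * qre y + qi x * qi y + qj x * qj y + qk x * qk y.
Definition qsqn x : R := qdot x x.
Definition qinv x : quat R := qscale (qsqn x)^-1 (qconj x).
Definition qcomp (e : 'I_4) x : R := nth 0 [:: qre x; qi x; qj x; qk x] e.

Ltac qunf := rewrite /ptadd /ptscale /qinv /qsqn /qdot /qscale /qconj /qadd
  /qmul /qzero /qre /qi /qj /qk /=.
Ltac qeq := repeat (let q := fresh "q" in move=> q; case: q => [[[? ?] ?] ?]);
  qunf; do ?[congr pair]; ring.

Lemma qmulA : associative (@qmul R). Proof. qeq. Qed.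
Lemma qaddA : associative (@qadd R). Proof. qeq. Qed.
Lemma qaddC : commutative (@qadd R). Proof. qeq. Qed.
Lemma qmulDl : left_distributive (@qmul R) (@qadd R). Proof. qeq. Qed.
Lemma qmulDr : right_distributive (@qmul R) (@qadd R). Proof. qeq. Qed.
Lemma qmul0r : left_zero (qzero R) (@qmul R). Proof. qeq. Qed.
Lemma qmulr0 : right_zero (qzero R) (@qmul R). Proof. qeq. Qed.
Lemma qadd0r : left_id (qzero R) (@qadd R). Proof. qeq. Qed.
Lemma qaddr0 : right_id (qzero R) (@qadd R). Proof. qeq. Qed.
Lemma qsub_eq : forall x y, y = qadd x (qadd y (qscale (-1) x)). Proof. qeq. Qed.
Lemma qsub_cancel : forall x y z,
  qadd (qadd x y) (qscale (-1) (qadd z y)) = qadd x (qscale (-1) z).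
Proof. qeq. Qed.
Lemma qscaleAl t : forall x y, qmul (qscale t x) y = qscale t (qmul x y).
Proof. qeq. Qed.
Lemma qscaleAr t : forall x y, qmul x (qscale t y) = qscale t (qmul x y).
Proof. qeq. Qed.
Lemma qscaleDr t : forall x y, qscale t (qadd x y) = qadd (qscale t x) (qscale t y).
Proof. qeq. Qed.
Lemma qscaleA t t' : forall x, qscale t (qscale t' x) = qscale (t * t') x.
Proof. qeq. Qed.
Lemma qscale1 : forall x, qscale 1 x = x. Proof. qeq. Qed.
Lemma qscaler0 t : qscale t (qzero R) = qzero R. Proof. qeq. Qed.

Lemma qsqnM : forall x y, qsqn (qmul x y) = qsqn x * qsqn y. Proof. qeq. Qed.
Lemma qsqnZ t : forall x, qsqn (qscale t x) = t ^+ 2 * qsqn x. Proof. qeq. Qed.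

Lemma qsqn_ge0 x : 0 <= qsqn x.
Proof. by rewrite /qsqn /qdot -!expr2 !addr_ge0 ?sqr_ge0. Qed.

Lemma qsqn_eq0 x : qsqn x = 0 -> x = qzero R.
Proof.
case: x => [[[a b] c] d]; rewrite /qsqn /qdot /qre /qi /qj /qk /= => h.
have [a0 [b0 [c0 d0]]] : a = 0 /\ b = 0 /\ c = 0 /\ d = 0.
  by repeat split; nra.
by rewrite a0 b0 c0 d0.
Qed.

Lemma qsqn_gt0 x : x <> qzero R -> 0 < qsqn x.
Proof.
move=> xN0; rewrite lt0r qsqn_ge0 andbT; apply/eqP => /qsqn_eq0.
exact: xN0.
Qed.

Lemma qmulVr : forall x, x <> qzero R -> qmul (qinv x) x = (1, 0, 0, 0).
Proof.
move=> x /qsqn_gt0; case: x => [[[a b] c] d].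
rewrite /qsqn /qdot /qre /qi /qj /qk /= => h.
by qunf; do ?[congr pair]; field; rewrite gt_eqF.
Qed.

Lemma qmulrV : forall x, x <> qzero R -> qmul x (qinv x) = (1, 0, 0, 0).
Proof.
move=> x /qsqn_gt0; case: x => [[[a b] c] d].
rewrite /qsqn /qdot /qre /qi /qj /qk /= => h.
by qunf; do ?[congr pair]; field; rewrite gt_eqF.
Qed.

Lemma qmul1r : left_id (1, 0, 0, 0) (@qmul R). Proof. qeq. Qed.
Lemma qmulr1 : right_id (1, 0, 0, 0) (@qmul R). Proof. qeq. Qed.

Lemma qsqnD_le : forall x y, qsqn (qadd x y) <= 2 * (qsqn x + qsqn y).
Proof.
move=> x y; have := qsqn_ge0 (qadd x (qscale (-1) y)).
case: x y => [[[a b] c] d] [[[a' b'] c'] d'].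
qunf; nra.
Qed.

Lemma sum_qcomp x y : \sum_e qcomp e x * qcomp e y = qdot x y.
Proof. by rewrite !big_ord_recl big_ord0 /qcomp /qdot /= addr0 !addrA. Qed.

Lemma qsqn_shear : forall x y z, qsqn (qadd x (qmul y (qconj z))) =
  qsqn x + 2 * qdot (qmul (qconj x) y) z + qsqn z * qsqn y.
Proof. qeq. Qed.

(** The multiplier is the conjugate of [t] times the [e]-th unit among 1, i, j, k. It lets a shear
    act to first order on one chosen real component of a correlation. *)
Lemma exists_shear (e : 'I_4) t : exists r, forall x y,
  qsqn (qadd x (qmul y r)) =
  qsqn x + 2 * t * qcomp e (qmul (qconj x) y) + t ^+ 2 * qsqn y.
Proof.
pose z : quat R := (t *+ (e == 0%N :> nat), t *+ (e == 1%N :> nat),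
                    t *+ (e == 2%N :> nat), t *+ (e == 3%N :> nat)).
exists (qconj z) => x y; rewrite qsqn_shear; congr (_ + _ + _ * _).
  rewrite -mulrA; congr (_ * _); move: (qmul _ _) => q.
  rewrite {}/z /qdot /qcomp; qunf.
  by case: e => [[|[|[|[|e]]]]] //= _; rewrite !mulr0 ?addr0 ?add0r mulrC.
rewrite {}/z; qunf.
by case: e => [[|[|[|[|e]]]]] //= _; rewrite !mulr0 ?addr0 ?add0r expr2.
Qed.

Lemma qdotDl : forall x y z, qdot (qadd x y) z = qdot x z + qdot y z.
Proof. qeq. Qed.
Lemma qdotDr : forall x y z, qdot x (qadd y z) = qdot x y + qdot x z.
Proof. qeq. Qed.

Lemma qdot_proj t : forall x y z z',
  qdot (qmul (qconj x) y) (qadd (qscale t (1, 0, 0, 0))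
                                (qscale (-1) (qmul z (qconj z')))) =
  t * qdot x y - qdot (qmul x z) (qmul y z').
Proof. qeq. Qed.

Lemma qsqn_proj t : forall x y,
  qsqn (qadd (qscale t (1, 0, 0, 0)) (qscale (-1) (qmul x (qconj y)))) =
  t ^+ 2 - 2 * t * qdot x y + qsqn x * qsqn y.
Proof. qeq. Qed.

Lemma ler_pM3 (a b c a' b' c' : R) : 0 <= a -> 0 <= b -> 0 <= c ->
  a <= a' -> b <= b' -> c <= c' -> a * b * c <= a' * b' * c'.
Proof. by move=> *; rewrite ler_pM ?mulr_ge0 ?ler_pM. Qed.

(** * Rank one Hermitian matrices and projections in H^3 *)

Section Veronese.
Implicit Types u w : 'I_3 -> quat R.
Definition sqnorm u : R := \sum_a qsqn (u a).

(* Real coordinates of the Hermitian matrix [conj (u a) * u b]; the dot product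
   of [veronese u] and [veronese v] is the squared modulus of the Hermitian
   product of [u] and [v]. *)
Definition veronese u (s : 'I_3 * 'I_3 * 'I_4) : R :=
  qcomp s.2 (qmul (qconj (u s.1.1)) (u s.1.2)).

(** The matrix |w|^2 I - w w^*, which is |w|^2 times the orthogonal projection onto the plane
    [lindot u w = 0], in the real coordinates of [veronese]; the scaling avoids a division. *)
Definition orthoproj w (s : 'I_3 * 'I_3 * 'I_4) : R :=
  qcomp s.2 (qadd (qscale (sqnorm w *+ (s.1.1 == s.1.2)) (1, 0, 0, 0))
                  (qscale (-1) (qmul (w s.1.1) (qconj (w s.1.2))))).

Lemma sum_idx (F : 'I_3 * 'I_3 * 'I_4 -> R) :
  \sum_s F s = \sum_a \sum_b \sum_e F (a, b, e).
Proof. by rewrite pair_bigA /= pair_bigA /=; apply: eq_bigr => [[[a b] e]]. Qed.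

Lemma sum_veronese_sqr u : \sum_s veronese u s ^+ 2 = sqnorm u ^+ 2.
Proof.
rewrite sum_idx expr2 {1}/sqnorm mulr_suml; apply: eq_bigr => a _.
rewrite mulr_sumr; apply: eq_bigr => b _.
under eq_bigr do rewrite expr2 /veronese /=.
rewrite sum_qcomp /=.
by case: (u a) (u b) => [[[? ?] ?] ?] [[[? ?] ?] ?]; qunf; ring.
Qed.

Definition lindot u w : quat R :=
  qadd (qadd (qmul (u 0) (w 0)) (qmul (u 1) (w 1))) (qmul (u 2%:R) (w 2%:R)).

Lemma big3 (F : 'I_3 -> R) : \sum_a F a = F 0 + F 1 + F 2%:R.
Proof.
rewrite !big_ord_recl big_ord0 addr0 addrA.
by congr (F _ + F _ + F _); apply: val_inj.
Qed.

Lemma sum_veronese_orthoproj u w :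
  \sum_s veronese u s * orthoproj w s =
  sqnorm u * sqnorm w - qsqn (lindot u w).
Proof.
rewrite sum_idx.
under eq_bigr => a _ do under eq_bigr => b _ do
  (rewrite /veronese /orthoproj /=; rewrite sum_qcomp qdot_proj).
rewrite !big3 /= !mulr1n !mulr0n !mul0r !sub0r /lindot.
rewrite [qsqn (qadd (qadd _ _) _)]/qsqn !(qdotDl, qdotDr) [sqnorm u]/sqnorm big3 /qsqn.
move: (qmul (u 0) (w 0)) (qmul (u 1) (w 1)) (qmul (u 2%:R) (w 2%:R)) => x y z.
by move: (u 0) (u 1) (u 2%:R) => p q r; ring.
Qed.

(** The factor 2 is the rank of the projection. *)
Lemma sum_orthoproj_sqr w : \sum_s orthoproj w s ^+ 2 = 2 * sqnorm w ^+ 2.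
Proof.
rewrite sum_idx.
under eq_bigr => a _ do under eq_bigr => b _ do
  (under eq_bigr do rewrite expr2 /orthoproj /=;
   rewrite sum_qcomp -/(qsqn _) qsqn_proj).
rewrite !big3 /= !mulr1n !mulr0n /sqnorm !big3 /qsqn.
by move: (w 0) (w 1) (w 2%:R) => x y z; ring.
Qed.

End Veronese.

(** * Lines in the quaternion plane *)

Implicit Types (p q r u v w : pt R).

Definition ptsub (v w : pt R) : pt R :=
  (qadd v.1 (qscale (-1) w.1), qadd v.2 (qscale (-1) w.2)).

Lemma on_line_base p v : on_line p v p.
Proof.
exists (qzero R); case: p v => p1 p2 [v1 v2].
by rewrite /ptadd /ptscale /= !qmul0r !qaddr0.
Qed.

Lemma on_line_sub p q : on_line p (ptsub q p) q.
Proof.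
exists (1, 0, 0, 0); case: p q => p1 p2 [q1 q2].
by rewrite /ptadd /ptscale /ptsub /= !qmul1r -!qsub_eq.
Qed.

Lemma ptsub_neq0 p q : p <> q -> ptsub q p <> ptzero R.
Proof.
case: p q => p1 p2 [q1 q2] pq e; apply: pq.
have e1 := congr1 fst e; have e2 := congr1 snd e.
by rewrite (qsub_eq p1 q1) (qsub_eq p2 q2) [qadd q1 _]e1 [qadd q2 _]e2 !qaddr0.
Qed.

(** The difference of the two points is [g] times [v] with [g] nonzero, and left multiplication by
    an invertible quaternion keeps the span of [v]. *)
Lemma on_line_eq p v a b : a <> b -> on_line p v a -> on_line p v b ->
  forall w, on_line a (ptsub b a) w <-> on_line p v w.
Proof.
move=> ab [x aE] [y bE] w.
pose g := qadd y (qscale (-1) x).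
have subE (c d : quat R) :
    qadd (qadd c (qmul y d)) (qscale (-1) (qadd c (qmul x d))) = qmul g d.
  rewrite /g qmulDl qscaleAl; move: c (qmul y d) (qmul x d); qeq.
have g0 : g <> qzero R.
  by move=> g0; apply: ab; rewrite aE bE (qsub_eq x y) -/g g0 qaddr0.
clearbody g; split=> -[z ->].
  exists (qadd x (qmul z g)); rewrite {}aE bE /ptadd /ptscale /ptsub /= !subE.
  by rewrite !qmulDl !qmulA !qaddA.
exists (qmul (qadd z (qscale (-1) x)) (qinv g)).
rewrite {}aE bE /ptadd /ptscale /ptsub /= !subE !qmulA -!(qmulA _ _ g).
rewrite !qmulVr // !qmulr1.
have cancel (c d : quat R) :
    qadd (qadd c (qmul x d)) (qmul (qadd z (qscale (-1) x)) d) =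
    qadd c (qmul z d).
  by rewrite qmulDl qscaleAl -qaddA -(qsub_eq (qmul x d)).
by rewrite !cancel.
Qed.

(** * Triangular frames: scalings, shears, normals and Hadamard's inequality *)

(* An upper triangular matrix with positive diagonal [fscale], acting on the
   homogeneous coordinates (X, Y, 1) of a point. *)
Record frame := Frame {
  fscale : 'I_3 -> R;
  fx : quat R; fy : quat R; fz : quat R;
  fscale_gt0 : forall a, 0 < fscale a }.
Implicit Types (f g : frame).

(** The matrix entries multiply on the right, which makes the map linear for left scalars; [crd]
    applies the diagonal afterwards. *)
Definition affine_crd f v (a : 'I_3) : quat R :=
  nth (qzero R) [:: qadd v.1 (qadd (qmul v.2 (fx f)) (fy f));
                    qadd v.2 (fz f); (1, 0, 0, 0)] a.
Definition crd f v (a : 'I_3) : quat R := qscale (fscale f a) (affine_crd f v a).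
Definition height f v : R := sqnorm (crd f v).
Definition logdet f : R := \sum_a ln (fscale f a).

Lemma height_scale f (a : 'I_3) t : 0 < t -> exists g,
  (forall v, height g v = height f v + (t ^+ 2 - 1) * qsqn (crd f v a)) /\
  logdet g = logdet f + ln t.
Proof.
move=> t0.
have gt0 b : 0 < (if b == a then t else 1) * fscale f b.
  by rewrite mulr_gt0 ?fscale_gt0 //; case: ifP.
exists (Frame (fx f) (fy f) (fz f) gt0); split=> [v|].
  rewrite /height /sqnorm [LHS](bigD1 a) // [in RHS](bigD1 a) //=.
  rewrite [RHS]addrAC; congr (_ + _).
    by rewrite /crd /= eqxx !qsqnZ /affine_crd /=; ring.
  by apply: eq_bigr => b /negPf ba; rewrite /crd /= ba mul1r.
rewrite /logdet [LHS](bigD1 a) // [in RHS](bigD1 a) //= eqxx.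
rewrite lnM ?posrE ?fscale_gt0 // -addrA addrC; congr (_ + _ + _).
by apply: eq_bigr => b /negPf ->; rewrite mul1r.
Qed.

Lemma crd_shear f (a b : 'I_3) (r : quat R) : (a < b)%N -> exists g,
  (forall v c, crd g v c =
     if c == a then qadd (crd f v a) (qmul (crd f v b) r) else crd f v c) /\
  logdet g = logdet f.
Proof.
have [r' sE] : exists r' : quat R, forall y,
    qscale (fscale f b) (qmul y r) = qscale (fscale f a) (qmul y r').
  (* The shear acts on scaled coordinates, so its entry before scaling is corrected by the ratio of
     the two scales. *)
  exists (qscale (fscale f b / fscale f a) r) => y.
  by rewrite qscaleAr qscaleA mulrCA divff ?mulr1 ?gt_eqF ?fscale_gt0.
have sa := fscale_gt0 f.
case: a b r' sE => [[|[|[|a]]]] // ha [[|[|[|b]]]] // hb r' sE // _.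
(* Coordinate 1 contains the translation [fz f], so adding a multiple of it to coordinate 0 also
   changes [fy]. *)
- exists (Frame (qadd (fx f) r') (qadd (fy f) (qmul (fz f) r')) (fz f) sa).
  split=> // v [[|[|[|c]]]] // hc.
  rewrite /crd (_ : hc = ha) ?eqxx; last exact: bool_irrelevance.
  rewrite qscaleAl sE -qscaleDr; congr (qscale _ _); rewrite /affine_crd /=.
  rewrite !qmulDr !qmulDl.
  by move: (qmul v.2 _) (qmul _ r') (qmul _ r') (fy f) v.1 {sE}; qeq.
- exists (Frame (fx f) (qadd (fy f) r') (fz f) sa).
  split=> // v [[|[|[|c]]]] // hc.
  rewrite /crd (_ : hc = ha) ?eqxx; last exact: bool_irrelevance.
  rewrite qscaleAl sE -qscaleDr; congr (qscale _ _); rewrite /affine_crd /=.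
  by rewrite qmul1r !qaddA.
- exists (Frame (fx f) (fy f) (qadd (fz f) r') sa).
  split=> // v [[|[|[|c]]]] // hc.
  rewrite /crd (_ : hc = ha) ?eqxx; last exact: bool_irrelevance.
  rewrite qscaleAl sE -qscaleDr; congr (qscale _ _); rewrite /affine_crd /=.
  by rewrite qmul1r !qaddA.
Qed.

Lemma height_shear f (a b : 'I_3) (e : 'I_4) t : (a < b)%N -> exists g,
  (forall v, height g v = height f v +
     2 * t * qcomp e (qmul (qconj (crd f v a)) (crd f v b)) +
     t ^+ 2 * qsqn (crd f v b)) /\
  logdet g = logdet f.
Proof.
move=> ab; have [r rE] := exists_shear e t.
have [g [gE gdet]] := crd_shear f r ab.
exists g; split=> // v; rewrite /height /sqnorm [LHS](bigD1 a) // [in RHS](bigD1 a) //=.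
rewrite gE eqxx rE (eq_bigr (fun c => qsqn (crd f v c))); first by ring.
by move=> c /negPf ca; rewrite gE ca.
Qed.

Lemma height_gt0 f v : 0 < height f v.
Proof.
have : 0 < qsqn (crd f v 2%:R).
  rewrite /crd qsqnZ mulr_gt0 ?exprn_gt0 ?fscale_gt0 //.
  by rewrite /affine_crd /=; qunf; rewrite !mul0r !addr0 mulr1.
rewrite /height /sqnorm big3.
by have := qsqn_ge0 (crd f v 0); have := qsqn_ge0 (crd f v 1); lra.
Qed.

Lemma line_normal p0 v : v <> ptzero R -> exists m1 m2 m3,
  (m1 <> qzero R \/ m2 <> qzero R) /\
  forall w, on_line p0 v w ->
    qadd (qadd (qmul w.1 m1) (qmul w.2 m2)) m3 = qzero R.
Proof.
case: p0 v => [p1 p2] [v1 v2] vN0.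
have one0 : (1, 0, 0, 0) <> qzero R by case=> /eqP; rewrite oner_eq0.
have [v10|v10] := pselect (v1 = qzero R).
  exists (1, 0, 0, 0), (qzero R), (qscale (-1) p1); split; first by left.
  move=> w [l ->] /=; rewrite v10 qmulr0 qmulr1 qmulr0.
  by move: p1 {v10 vN0}; qeq.
(* The line is y = x m + c with slope m = v1^-1 v2; its normal is (m, -1, c). *)
exists (qmul (qinv v1) v2), (qscale (-1) (1, 0, 0, 0)).
exists (qadd p2 (qscale (-1) (qmul p1 (qmul (qinv v1) v2)))).
split.
  by right=> /(congr1 (@qre R)); qunf; lra.
move=> w [l ->] /=; rewrite qmulDl -[qmul (qmul l v1) _]qmulA [qmul v1 _]qmulA.
rewrite qmulrV; last exact: v10.
rewrite qmul1r qscaleAr qmulr1; move: p2 (qmul l v2) (qmul p1 _) {vN0}.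
by qeq.
Qed.

(** The new normal is the inverse matrix of the frame applied to the normal of the line, computed by
    back substitution. *)
Lemma crd_normal f p0 v : v <> ptzero R -> exists w : 'I_3 -> quat R,
  0 < sqnorm w /\ forall u, on_line p0 v u -> lindot (crd f u) w = qzero R.
Proof.
move=> /(line_normal p0) [m1 [m2 [m3 [mN0 mE]]]].
pose w1 := qscale (fscale f 0)^-1 m1.
pose n2 := qadd m2 (qscale (-1) (qmul (fx f) m1)).
pose w2 := qscale (fscale f 1)^-1 n2.
pose w3 := qscale (fscale f 2%:R)^-1
  (qadd m3 (qscale (-1) (qadd (qmul (fy f) m1) (qmul (fz f) n2)))).
pose w (a : 'I_3) := nth (qzero R) [:: w1; w2; w3] a.
have sV a y : qscale (fscale f a) (qscale (fscale f a)^-1 y) = y.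
  by rewrite qscaleA divff ?qscale1 ?gt_eqF ?fscale_gt0.
exists w; split.
  rewrite /sqnorm big3 /w /=.
  have [m10|m10] := pselect (m1 = qzero R); last first.
    have : 0 < qsqn w1.
      by apply: qsqn_gt0 => w10; apply: m10; rewrite -(sV 0 m1) -/w1 w10 qscaler0.
    by have := qsqn_ge0 w2; have := qsqn_ge0 w3; lra.
  case: mN0 => // m20.
  have : 0 < qsqn w2.
    apply: qsqn_gt0 => w20; apply: m20.
    have : n2 = qzero R by rewrite -(sV 1 n2) -/w2 w20 qscaler0.
    by rewrite /n2 m10 qmulr0 qscaler0 qaddr0.
  by have := qsqn_ge0 w1; have := qsqn_ge0 w3; lra.
move=> u /mE; rewrite /lindot /w /= /crd !qscaleAl -!qscaleAr !sV /affine_crd /=.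
move=> <-; rewrite qmul1r !qmulDl -qmulA {1}/n2 qmulDr qscaleAr.
move: m3 (qmul u.1 m1) (qmul u.2 m2) (qmul u.2 (qmul (fx f) m1))
  (qmul (fy f) m1) (qmul (fz f) n2) {mE w3 w sV}.
by qeq.
Qed.

(* Hadamard's inequality with the Dieudonne determinant of the triple; the
   monotonicity of the heights is what makes Gram-Schmidt unnecessary. *)
Lemma hadamard p q r : p <> q -> ~ on_line p (ptsub q p) r -> exists2 K : R, 0 < K &
  forall f, height f p <= height f q -> height f q <= height f r ->
    K * (\prod_a fscale f a) ^+ 2 <= height f p * height f q * height f r.
Proof.
case: p q r => [p1 p2] [q1 q2] [r1 r2]; rewrite /ptsub /= => pq noncol.
have sub_le (f : frame) a u v : qsqn (qscale (fscale f a)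
    (qadd (affine_crd f u a) (qscale (-1) (affine_crd f v a)))) <=
    2 * (height f u + height f v).
  have crd_le w : qsqn (crd f w a) <= height f w.
    by rewrite /height /sqnorm (bigD1 a) //= lerDl sumr_ge0 // => b _; apply: qsqn_ge0.
  rewrite qscaleDr qscaleA [_ * -1]mulrC -qscaleA.
  apply: (le_trans (qsqnD_le _ _)); rewrite ler_pM2l // lerD //.
    exact: crd_le.
  by rewrite qsqnZ sqrrN expr1n mul1r; apply: crd_le.
pose x1 := qadd q1 (qscale (-1) p1); pose y1 := qadd q2 (qscale (-1) p2).
pose x2 := qadd r1 (qscale (-1) p1); pose y2 := qadd r2 (qscale (-1) p2).
(* [top], [mid] and [low] control the three diagonal entries. Differences of points remove the
   translations [fz] and [fy]; only [low] still involves [fx]. *)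
have top f u : (fscale f 2%:R) ^+ 2 <= height f u.
  rewrite /height /sqnorm big3 /crd !qsqnZ /affine_crd /=.
  rewrite (_ : qsqn (1, 0, 0, 0) = 1) ?mulr1; last first.
    by qunf; rewrite !mul0r !addr0 mulr1.
  by rewrite lerDr addr_ge0 // mulr_ge0 ?sqr_ge0 ?qsqn_ge0.
have mid f u v : (fscale f 1) ^+ 2 * qsqn (qadd u.2 (qscale (-1) v.2)) <=
    2 * (height f u + height f v).
  rewrite -qsqnZ; apply: le_trans (sub_le f 1 u v).
  rewrite /affine_crd /= le_eqVlt; apply/orP; left; apply/eqP.
  by rewrite qsub_cancel.
have low f u v : qsqn (qscale (fscale f 0) (qadd (qadd u.1 (qscale (-1) v.1))
      (qmul (qadd u.2 (qscale (-1) v.2)) (fx f)))) <= 2 * (height f u + height f v).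
  apply: le_trans (sub_le f 0 u v).
  rewrite /affine_crd /= le_eqVlt; apply/orP; left; apply/eqP.
  congr (qsqn (qscale _ _)); rewrite qmulDl qscaleAl.
  by move: u.1 v.1 (qmul u.2 _) (qmul v.2 _) (fy f); qeq.
have prodE f : (\prod_a fscale f a) ^+ 2 =
    fscale f 0 ^+ 2 * fscale f 1 ^+ 2 * fscale f 2%:R ^+ 2.
  rewrite !big_ord_recl big_ord0 mulr1 !exprMn mulrA.
  by congr (fscale f _ ^+ 2 * fscale f _ ^+ 2 * fscale f _ ^+ 2); apply: val_inj.
have [y10|y10] := pselect (y1 = qzero R).
  have x10 : 0 < qsqn x1.
    apply: qsqn_gt0 => x10; apply: pq.
    by rewrite (qsub_eq p1 q1) (qsub_eq p2 q2) -/x1 -/y1 x10 y10 !qaddr0.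
  have y20 : 0 < qsqn y2.
    apply: qsqn_gt0 => y20; apply: noncol; exists (qmul x2 (qinv x1)).
    rewrite /ptadd /ptscale /= -/x1 -/y1 y10 -qmulA qmulVr ?qmulr1 ?qmulr0.
      by rewrite {1}(qsub_eq p1 r1) {1}(qsub_eq p2 r2) -/x2 -/y2 y20.
    by move=> x1z; move: x10; rewrite x1z; qunf; rewrite !mulr0 !addr0 ltxx.
  (* As [y1] vanishes, [fx] drops out of [low] for q. The ordering turns each bound 2 (a + b) into 4
     times the larger height, whence 16 = 4 * 4. *)
  exists (qsqn x1 * qsqn y2 / 16%:R); first by rewrite divr_gt0 ?mulr_gt0.
  move=> f pq_le qr_le; rewrite prodE.
  have hp := top f (p1, p2).
  have hr := mid f (r1, r2) (p1, p2).
  have := low f (q1, q2) (p1, p2).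
  rewrite /= -/x1 -/y1 y10 qmul0r qaddC qadd0r qsqnZ => hq.
  rewrite /= -/y2 in hr.
  move: (height f (p1, p2)) (height f (q1, q2)) (height f (r1, r2))
    pq_le qr_le hp hr hq => a b c.
  move=> pq_le qr_le hp hr hq.
  apply: (@le_trans _ _ (fscale f 0 ^+ 2 * qsqn x1 * (fscale f 1 ^+ 2 * qsqn y2) *
      fscale f 2%:R ^+ 2 / 16%:R)).
    by rewrite le_eqVlt; apply/orP; left; apply/eqP; field.
  rewrite ler_pdivrMr // (_ : _ * 16%:R = (4%:R * b) * (4%:R * c) * a); last by ring.
  by apply: ler_pM3; rewrite ?mulr_ge0 ?qsqn_ge0 ?(ltW (fscale_gt0 _ _)) //; lra.
(* Gaussian elimination: r - p - l (q - p) = (d, 0), and [d] is nonzero because r is off the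
   line. *)
pose l := qmul y2 (qinv y1); pose d := qadd x2 (qscale (-1) (qmul l x1)).
have lE : qmul l y1 = y2 by rewrite /l -qmulA qmulVr // qmulr1.
have d0 : 0 < qsqn d.
  apply: qsqn_gt0 => d0; apply: noncol; exists l.
  rewrite /ptadd /ptscale /= -/x1 -/y1 lE {1}(qsub_eq p1 r1) {1}(qsub_eq p2 r2).
  by rewrite -/x2 -/y2 {1}(qsub_eq (qmul l x1) x2) -/d d0 qaddr0.
have l0 := qsqn_ge0 l; have l1 : 0 < 1 + qsqn l by lra.
(* A factor 4 comes from [hq] and a factor 8 (1 + |l|^2) from [hr], the bound for the eliminated
   row. *)
exists (qsqn d * qsqn y1 / (32%:R * (1 + qsqn l))).
  by have y1_gt0 := qsqn_gt0 y10; rewrite divr_gt0 ?mulr_gt0.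
move=> f pq_le qr_le; rewrite prodE.
have hp := top f (p1, p2).
have hq := mid f (q1, q2) (p1, p2).
have hq' := low f (q1, q2) (p1, p2).
have hr' := low f (r1, r2) (p1, p2).
rewrite /= -/y1 in hq; rewrite /= -/x1 -/y1 in hq'.
rewrite /= -/x2 -/y2 in hr'; rewrite !qsqnZ in hq' hr'.
have hr : fscale f 0 ^+ 2 * qsqn d <= 8%:R * (1 + qsqn l) * height f (r1, r2).
  have := qsqnD_le (qscale (fscale f 0) (qadd x2 (qmul y2 (fx f))))
    (qscale (-1) (qmul l (qscale (fscale f 0) (qadd x1 (qmul y1 (fx f)))))).
  rewrite [qsqn (qscale (-1) _)]qsqnZ sqrrN expr1n mul1r qsqnM.
  rewrite qscaleAr qscaleA [-1 * _]mulrC -qscaleA.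
  rewrite -qscaleDr [X in qscale _ X](_ : _ = d) ?qsqnZ => [le_d|].
    apply: (le_trans le_d).
    have hB : 2 * (height f (q1, q2) + height f (p1, p2)) <= 4%:R * height f (r1, r2).
      by lra.
    have {}hB := ler_wpM2l l0 (le_trans hq' hB).
    move: (height f (p1, p2)) (height f (q1, q2)) (height f (r1, r2))
      pq_le qr_le hr' hB.
    by move=> a b c *; nra.
  by rewrite -lE /d qmulDr qmulA qsub_cancel.
apply: (@le_trans _ _ (fscale f 0 ^+ 2 * qsqn d * (fscale f 1 ^+ 2 * qsqn y1) *
    fscale f 2%:R ^+ 2 / (32%:R * (1 + qsqn l)))).
  by rewrite le_eqVlt; apply/orP; left; apply/eqP; ring.
move: (height f (p1, p2)) (height f (q1, q2)) (height f (r1, r2))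
  pq_le qr_le hp hq hr {hq' hr'} => a b c.
move=> pq_le qr_le hp hq hr.
rewrite ler_pdivrMr ?mulr_gt0 // (_ : _ * (32%:R * _) =
  (8%:R * (1 + qsqn l) * c) * (4%:R * b) * a); last by ring.
by apply: ler_pM3; rewrite ?mulr_ge0 ?qsqn_ge0 ?(ltW (fscale_gt0 _ _)) //; lra.
Qed.

(** * Combinatorics of lines in a finite set *)

Section Lines.
Variables (I : finType) (L : I -> I -> {set I}).
Hypothesis Ll : forall i j, i \in L i j.
Hypothesis Lr : forall i j, j \in L i j.
Hypothesis L_eq : forall {i j a b},
  a != b -> a \in L i j -> b \in L i j -> L a b = L i j.

(** Ordered pairs of distinct points are partitioned by the line that they span. *)
Lemma sum_lines_ge0 (F : I * I -> R) :
  (forall i j, i != j ->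
     0 <= \sum_(ab | (ab.1 != ab.2) && ((ab.1 \in L i j) && (ab.2 \in L i j))) F ab) ->
  0 <= \sum_(ab | ab.1 != ab.2) F ab.
Proof.
move=> line_ge0.
rewrite (partition_big (fun ab => L ab.1 ab.2) predT) //=.
apply: sumr_ge0 => l _.
have [[i j] /= /andP[ij /eqP <-]|none] :=
    pickP (fun ab : I * I => (ab.1 != ab.2) && (L ab.1 ab.2 == l)); last first.
  by rewrite big_pred0.
rewrite (eq_bigl (fun ab => (ab.1 != ab.2) &&
  ((ab.1 \in L i j) && (ab.2 \in L i j)))); first exact: line_ge0.
move=> [a b]; have [//|ab] /= := eqVneq a b.
apply/eqP/andP => [<-|[aL bL]]; first by rewrite Ll Lr.
exact: L_eq.
Qed.

(** Send each m of the line to a third point of the line through k and m. This map is injective and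
    leaves the line, since two lines sharing two points coincide and k is off the line. *)
Lemma double_card_line i j k : (forall a b, a != b -> (3 <= #|L a b|)%N) ->
  i != j -> k \notin L i j -> (2 * #|L i j| <= #|I|)%N.
Proof.
move=> L3 ij kL.
have kN m : m \in L i j -> k != m by apply: contraTneq => <-.
(* The choice needs a total function; values for m off the line are arbitrary. *)
have third m : exists s, m \in L i j -> s \in L k m :\ k :\ m.
  have [qL|] := boolP (m \in L i j); last by exists m.
  have : (0 < #|L k m :\ k :\ m|)%N.
    rewrite -(ltn_add2l 2) addn0 (leq_trans (L3 _ _ (kN _ qL))) //.
    rewrite (cardsD1 k) (cardsD1 m (_ :\ _)) addnA leq_add2r.
    by case: (_ \in _); case: (_ \in _).
  by case/card_gt0P => s; exists s.
have /choice [g gP] := third.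
have {}gP m : m \in L i j -> [/\ g m != m, g m != k & g m \in L k m].
  by move=> /gP; rewrite !inE => /and3P.
have g_inj : {in L i j &, injective g}.
  move=> m m' qL m'L gE; apply: contraNeq kL => qq'.
  have [_ gk gL] := gP m qL; have [_ gk' gL'] := gP m' m'L.
  have kqq : L k m = L k m'.
    rewrite -(L_eq (_ : k != g m) (Ll k m) gL) 1?eq_sym // gE.
    by rewrite (L_eq (_ : k != g m') (Ll k m') gL') 1?eq_sym.
  have m'kq : m' \in L k m by rewrite kqq.
  by rewrite -(L_eq qq' qL m'L) (L_eq qq' (Lr k m) m'kq).
have g_out : [disjoint L i j & [set g m | m in L i j]].
  apply/pred0P => s /=; apply/negP => /andP[rL /imsetP[m qL rE]].
  have [gq _ gL] := gP m qL; move: kL.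
  by rewrite -(L_eq gq (_ : g m \in L i j) qL) -?rE // rE (L_eq gq gL (Lr k m)) Ll.
rewrite mul2n -addnn -{2}(card_in_imset g_inj).
by rewrite -leq_card_setU in g_out; rewrite -(eqP g_out) max_card.
Qed.
End Lines.

(** * Energy of the normalised points and the potential *)

Section Energy.
Variables (I : finType) (P : I -> pt R).
Implicit Types (A : {set I}).
Local Notation N := (#|I|%:R : R).

(** As [veronese] is quadratic, dividing by the squared norm yields the matrix u_i^* u_i of the unit
    vector; hence [gram] is |<u_a, u_b>|^2. *)
Definition feature f i s : R := veronese (crd f (P i)) s / height f (P i).
Definition gram f a b : R := \sum_s feature f a s * feature f b s.

Lemma gram_diag f a : gram f a a = 1.
Proof.
rewrite /gram /feature.
under eq_bigr do rewrite -expr2 expr_div_n.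
by rewrite -mulr_suml sum_veronese_sqr divff ?expf_neq0 ?gt_eqF ?height_gt0.
Qed.

Lemma sum_gram f A :
  \sum_(a in A) \sum_(b in A) gram f a b = \sum_s (\sum_(a in A) feature f a s) ^+ 2.
Proof.
under eq_bigr do rewrite exchange_big /=.
rewrite exchange_big /=; apply: eq_bigr => s _.
rewrite expr2 mulr_suml; apply: eq_bigr => a _.
by rewrite mulr_sumr.
Qed.

Lemma sum_offdiag A (F : I * I -> R) :
  \sum_(ab | (ab.1 != ab.2) && ((ab.1 \in A) && (ab.2 \in A))) F ab =
  \sum_(a in A) \sum_(b in A) F (a, b) - \sum_(a in A) F (a, a).
Proof.
rewrite -sumrB.
under [RHS]eq_bigr => a aA do rewrite (bigD1 a) //= addrAC subrr add0r.
rewrite pair_big_dep /=; apply: eq_big => [[a b]|[a b]] //=.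
by rewrite eq_sym; case: (a \in A); case: (b \in A); case: (_ == _).
Qed.

(* Cauchy-Schwarz against the orthogonal projection onto the span of the line,
   which has trace 2. *)
Lemma line_energy f A p v : v <> ptzero R -> (forall a, a \in A -> on_line p v (P a)) ->
  #|A|%:R ^+ 2 / 2 <= \sum_s (\sum_(a in A) feature f a s) ^+ 2.
Proof.
move=> v0 Aline; have [w [W0 wE]] := crd_normal f p v0.
set G := fun s => \sum_(a in A) feature f a s.
have GP : \sum_s G s * orthoproj w s = #|A|%:R * sqnorm w.
  under eq_bigr do rewrite /G mulr_suml.
  rewrite exchange_big /= mulr_natl -sumr_const; apply: eq_bigr => a aA.
  rewrite /feature; under eq_bigr do rewrite mulrAC.
  rewrite -mulr_suml sum_veronese_orthoproj (wE _ (Aline _ aA)) -/(height f (P a)).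
  rewrite (_ : qsqn (qzero R) = 0) ?subr0; last by qunf; ring.
  by rewrite mulrAC divff ?mul1r // gt_eqF ?height_gt0.
move: (sqnorm w) (#|A|%:R : R) W0 GP (sum_orthoproj_sqr w) => W k W0 GP PP.
(* This [t] minimises the squared distance from [G] to the multiples of the projection. *)
pose t := k / (2 * W).
have : 0 <= \sum_s (G s - t * orthoproj w s) ^+ 2.
  by apply: sumr_ge0 => s _; apply: sqr_ge0.
have -> : \sum_s (G s - t * orthoproj w s) ^+ 2 =
    \sum_s G s ^+ 2 - 2 * t * (k * W) + t ^+ 2 * (2 * W ^+ 2).
  rewrite -GP -PP !mulr_sumr -sumrB -big_split /=.
  by apply: eq_bigr => s _; ring.
have -> : 2 * t * (k * W) = k ^+ 2 by rewrite /t; field; rewrite gt_eqF.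
have -> : t ^+ 2 * (2 * W ^+ 2) = k ^+ 2 / 2 by rewrite /t; field; rewrite gt_eqF.
by rewrite /G; lra.
Qed.

(** The weights 3 and 2N cancel under a common rescaling of the three coordinates. *)
Definition potential f : R :=
  3 * \sum_i ln (height f (P i)) - 2 * N * logdet f.

(** Each ratio of heights is 1 + x with ln (1 + x) <= x, so the logarithms change by at most the
    linear term. *)
Lemma potential_step f g (D : pt R -> R) :
  (forall v, height g v = height f v + D v) ->
  potential g <= potential f + 3 * (\sum_i D (P i) / height f (P i))
                 - 2 * N * (logdet g - logdet f).
Proof.
move=> gE; rewrite /potential.
suff : \sum_i ln (height g (P i)) <=
    \sum_i ln (height f (P i)) + \sum_i D (P i) / height f (P i).
  by move: (\sum_i ln _) (\sum_i ln _) (\sum_i _ / _) => *; nra.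
rewrite -big_split /=; apply: ler_sum => i _.
have f0 := height_gt0 f (P i); have g0 := height_gt0 g (P i).
have -> : height g (P i) = height f (P i) * (1 + D (P i) / height f (P i)).
  by rewrite gE; field; rewrite gt_eqF.
have d0 : 0 < 1 + D (P i) / height f (P i).
  rewrite (_ : 1 + _ = height g (P i) / height f (P i)) ?divr_gt0 //.
  by rewrite gE; field; rewrite gt_eqF.
rewrite lnM ?posrE // lerD2l le_ln1Dx //; lra.
Qed.

(** * Near-minimisers are nearly isotropic *)

Section NearMinimum.
Variable f : frame.
Hypothesis N_gt0 : 0 < N.
Hypothesis f_min : forall g, potential f - N / 200%:R <= potential g.

Lemma diag_feature i a : feature f i (a, a, 0) = qsqn (crd f (P i) a) / height f (P i).
Proof.
rewrite /feature /veronese /qcomp /=; congr (_ / _).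
by move: (crd _ _ _); qeq.
Qed.

Lemma diag_feature0 i a (e : 'I_4) : e != 0 -> feature f i (a, a, e) = 0.
Proof.
rewrite /feature /veronese /qcomp /= => e0; rewrite (_ : nth _ _ _ = 0) ?mul0r //.
move: (crd _ _ _) => q; case: e e0 => [[|[|[|[|e]]]]] //= _ _.
all: by move: q; qeq.
Qed.

(** The matrices are Hermitian: transposed entries are conjugate, so components agree up to a sign
    that squaring removes. *)
Lemma sum_feature_sym a b (e : 'I_4) :
  (\sum_i feature f i (b, a, e)) ^+ 2 = (\sum_i feature f i (a, b, e)) ^+ 2.
Proof.
pose sg : R := if e == 0%N :> nat then 1 else -1.
have sg2 : sg ^+ 2 = 1 by rewrite /sg; case: ifP; rewrite ?sqrrN expr1n.
rewrite -[RHS]mul1r -sg2 -exprMn mulr_sumr; congr (_ ^+ 2).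
apply: eq_bigr => i _; rewrite /feature mulrA; congr (_ / _).
rewrite /veronese /qcomp /sg /=; move: (crd _ _ a) (crd _ _ b) {sg sg2}.
by case: e => [[|[|[|[|e]]]]] //= _; qeq.
Qed.

Lemma sum_diag_feature : \sum_a \sum_i feature f i (a, a, 0) = N.
Proof.
rewrite exchange_big /= -[RHS]mulr1 mulr_natl -sumr_const; apply: eq_bigr => i _.
under eq_bigr do rewrite diag_feature.
by rewrite -mulr_suml divff // gt_eqF ?height_gt0.
Qed.

(** Shrinking coordinate [a] by 19/20 gains 117/400 of the diagonal sum and costs at most 2N/19 in
    the determinant term; with the tolerance N/200 the sum stays below 38/100 N. *)
Lemma diag_le a : \sum_i feature f i (a, a, 0) <= 38%:R / 100%:R * N.
Proof.
have t0 : 0 < 19%:R / 20%:R :> R by rewrite divr_gt0.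
have [g [gE gdet]] := height_scale f a t0.
have := f_min g; have := potential_step gE.
rewrite gdet (addrC (logdet f)) addrK.
have -> : \sum_i ((19%:R / 20%:R) ^+ 2 - 1) * qsqn (crd f (P i) a) / height f (P i) =
    ((19%:R / 20%:R) ^+ 2 - 1) * \sum_i feature f i (a, a, 0).
  by rewrite mulr_sumr; apply: eq_bigr => i _; rewrite diag_feature mulrA.
have ln_ge : - (1 / 19%:R) <= ln (19%:R / 20%:R : R).
  rewrite -[X in ln X]invrK lnV ?posrE ?invr_gt0 // lerN2.
  rewrite (_ : _^-1 = 1 + 1 / 19%:R :> R); last by field.
  by rewrite le_ln1Dx //; lra.
have := ler_wpM2l (ltW N_gt0) ln_ge.
move: (ln _) (\sum_i _) (potential f) (potential g) => l d F G.
have -> : 2 * N * l = 2 * (N * l) by ring.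
rewrite (_ : (19%:R / 20%:R) ^+ 2 - 1 = - (39%:R / 400%:R)); last by field.
by move: (N * l) N (N_gt0) => nl n *; lra.
Qed.

Lemma offdiag_le (a b : 'I_3) (e : 'I_4) : (a < b)%N ->
  (\sum_i feature f i (a, b, e)) ^+ 2 <= N ^+ 2 / 300%:R.
Proof.
(* This [t] minimises 2 t o + t^2 N. The shear lowers the potential by at least 3 o^2 / N, which
   near-minimality caps at N/200. *)
move=> ab; set o := \sum_i _; pose t := - o / N.
have [g [gE gdet]] := height_shear f e t ab.
have {}gE v : height g v = height f v +
    (2 * t * qcomp e (qmul (qconj (crd f v a)) (crd f v b)) +
     t ^+ 2 * qsqn (crd f v b)) by rewrite gE addrA.
have := f_min g; have := potential_step gE.
rewrite gdet subrr mulr0 subr0.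
have -> : \sum_i (2 * t * qcomp e (qmul (qconj (crd f (P i) a)) (crd f (P i) b)) +
    t ^+ 2 * qsqn (crd f (P i) b)) / height f (P i) =
    2 * t * o + t ^+ 2 * \sum_i feature f i (b, b, 0).
  rewrite /o !mulr_sumr -big_split /=; apply: eq_bigr => i _.
  by rewrite diag_feature /feature /veronese /=; ring.
have d_le : \sum_i feature f i (b, b, 0) <= N.
  by apply: le_trans (diag_le b) _; rewrite ler_piMl ?(ltW N_gt0) //; lra.
have := ler_wpM2l (sqr_ge0 t) d_le.
move: (\sum_i _) (potential f) (potential g) => d F G h1 h2 h3.
have : 2 * t * o + t ^+ 2 * N = - (o ^+ 2 / N) by rewrite /t; field; rewrite gt_eqF.
have o2 : o ^+ 2 = o ^+ 2 / N * N by field; rewrite gt_eqF.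
rewrite [X in X <= _]o2 => h4.
have h5 : o ^+ 2 / N <= N / 300%:R.
  by move: (t ^+ 2 * d) (t ^+ 2 * N) (2 * t * o) (o ^+ 2 / N)
    N (N_gt0) h1 h2 h3 h4 => *; lra.
by apply: le_trans (ler_wpM2r (ltW N_gt0) h5) _; rewrite [N ^+ 2]expr2 mulrAC.
Qed.

(* 38/100 + 24 / 300 = 23/50, just below the 23/48 that lines of 25 points force. *)
Lemma energy_le : \sum_s (\sum_i feature f i s) ^+ 2 <= 23%:R / 50%:R * N ^+ 2.
Proof.
rewrite sum_idx.
pose d a := \sum_i feature f i (a, a, 0).
(* Diagonal entries are real; each of the six others has four real components, which gives the 24
   below. *)
apply: (@le_trans _ _ (\sum_a \sum_b
    (if a == b then d a ^+ 2 else 4%:R * (N ^+ 2 / 300%:R)))).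
  apply: ler_sum => a _; apply: ler_sum => b _.
  have [<-|ab] := eqVneq a b.
    rewrite (bigD1 0) //= [X in _ + X]big1 ?addr0 // => e e0.
    by rewrite big1 ?expr0n // => i _; rewrite diag_feature0.
  rewrite mulr_natl -[X in _ *+ X](card_ord 4) -sumr_const; apply: ler_sum => e _.
  have [ba|ba|/val_inj ba] := ltngtP a b; last by rewrite ba eqxx in ab.
    exact: offdiag_le.
  by rewrite sum_feature_sym offdiag_le.
have dN := sum_diag_feature; rewrite -/d in dN.
have d0 a : 0 <= d a.
  by apply: sumr_ge0 => i _; rewrite diag_feature divr_ge0 ?qsqn_ge0 ?ltW ?height_gt0.
have dle a : d a ^+ 2 <= 38%:R / 100%:R * N * d a.
  by rewrite expr2 ler_wpM2r ?d0 ?diag_le.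
have -> : \sum_a \sum_b (if a == b then d a ^+ 2 else 4%:R * (N ^+ 2 / 300%:R)) =
   d 0 ^+ 2 + d 1 ^+ 2 + d 2%:R ^+ 2 + 24%:R * (N ^+ 2 / 300%:R).
  by rewrite !big3 /=; ring.
rewrite big3 -!/(d _) in dN.
have := lerD (lerD (dle 0) (dle 1)) (dle 2%:R).
rewrite -!mulrDr dN (_ : _ * N = 38%:R / 100%:R * N ^+ 2); last by ring.
by move: (N ^+ 2) (d _ ^+ 2) (d _ ^+ 2) (d _ ^+ 2) => *; lra.
Qed.
End NearMinimum.
End Energy.

(** * Lower bound for the potential, and the contradiction when every line is rich *)

Section RichLines.
Variables (I : finType) (P : I -> pt R).
Hypothesis P_inj : injective P.
Implicit Types (i j k : I).
Local Notation N := (#|I|%:R : R).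

Definition line_set i j : {set I} :=
  [set k | `[< on_line (P i) (ptsub (P j) (P i)) (P k) >]].

Lemma line_setP i j k :
  reflect (on_line (P i) (ptsub (P j) (P i)) (P k)) (k \in line_set i j).
Proof. by rewrite inE; apply: asboolP. Qed.

Lemma P_neq i j : i != j -> P i <> P j.
Proof. by move=> /eqP ij /P_inj. Qed.

Lemma line_setl i j : i \in line_set i j.
Proof. by apply/line_setP; apply: on_line_base. Qed.

Lemma line_setr i j : j \in line_set i j.
Proof. by apply/line_setP; apply: on_line_sub. Qed.

Lemma line_set_eq i j a b : a != b ->
  a \in line_set i j -> b \in line_set i j -> line_set a b = line_set i j.
Proof.
move=> /P_neq ab /line_setP aL /line_setP bL; apply/setP => k.
have eqL := on_line_eq ab aL bL (P k).
by apply/line_setP/line_setP => /eqL.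
Qed.

Lemma exists_argmin (Q : pred I) (h : I -> R) : (exists i, Q i) ->
  exists2 i, Q i & forall j, Q j -> h i <= h j.
Proof. by case=> i0 Qi0; case: (arg_minP h Qi0) => i Qi le_h; exists i. Qed.

(** The constant of [hadamard] depends on the triple but not on the frame; summing absolute values
    over the finitely many triples makes it uniform. *)
Lemma hadamard_ln : exists C : R, forall i j k, i != j -> k \notin line_set i j ->
  forall f, height f (P i) <= height f (P j) -> height f (P j) <= height f (P k) ->
  2 * logdet f <= ln (height f (P i)) + ln (height f (P j)) + ln (height f (P k)) + C.
Proof.
have bound (t : I * I * I) : exists c : R,
  t.1.1 != t.1.2 -> t.2 \notin line_set t.1.1 t.1.2 -> forall f,
  height f (P t.1.1) <= height f (P t.1.2) -> height f (P t.1.2) <= height f (P t.2) ->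
  2 * logdet f <=
    ln (height f (P t.1.1)) + ln (height f (P t.1.2)) + ln (height f (P t.2)) + c.
  case: t => [[i j] k] /=.
  have [ij|] := boolP (i != j); last by exists 0.
  have [//|kL] := boolP (k \in line_set i j); first by exists 0.
  have noncol : ~ on_line (P i) (ptsub (P j) (P i)) (P k).
    by move/line_setP; apply/negP.
  have [K K0 hK] := hadamard (P_neq ij) noncol.
  exists (- ln K) => _ _ f ij_le jk_le.
  have := hK f ij_le jk_le.
  have prod_gt0 : 0 < \prod_a fscale f a by apply: prodr_gt0 => a _; apply: fscale_gt0.
  have ln_prod : ln (\prod_a fscale f a) = logdet f.
    rewrite /logdet !big_ord_recl !big_ord0 mulr1 addr0.
    by rewrite !lnM ?posrE ?mulr_gt0 ?fscale_gt0.
  rewrite -ler_ln ?posrE ?mulr_gt0 ?exprn_gt0 ?height_gt0 //.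
  rewrite !lnM ?posrE ?mulr_gt0 ?exprn_gt0 ?height_gt0 // -ln_prod.
  by lra.
have /choice [c hc] := bound.
exists (\sum_t `|c t|) => i j k ij kL f h1 h2.
apply: le_trans (hc (i, j, k) ij kL f h1 h2) _; rewrite lerD2l.
rewrite (bigD1 (i, j, k)) //= (le_trans (ler_norm _)) // lerDl.
by apply: sumr_ge0 => t _; apply: normr_ge0.
Qed.

Hypothesis line_ge25 : forall i j, i != j -> (25 <= #|line_set i j|)%N.
Hypothesis noncol : forall i j, i != j -> exists k, k \notin line_set i j.
Variables i0 j0 : I.
Hypothesis i0j0 : i0 != j0.

(* The two points of smallest height span a line containing at most half of the
   points, so Hadamard's inequality for the flag of smallest heights suffices. *)
Lemma potential_bounded : exists C : R, forall f, C <= potential P f.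
Proof.
have [C hC] := hadamard_ln.
exists (- N * C) => f; set h := fun i => height f (P i).
have [i _ i_min] := exists_argmin h (ex_intro xpredT i0 isT).
have [j ij j_min] : exists2 j, i != j & forall k, i != k -> h j <= h k.
  apply: exists_argmin; have [<-|] := eqVneq i0 i; first by exists j0.
  by rewrite eq_sym => ii0; exists i0.
have [k kL k_min] := exists_argmin h (noncol ij).
have ik : i != k by apply: contraNneq kL => <-; apply: line_setl.
have half : (2 * #|line_set i j| <= #|I|)%N.
  apply: (double_card_line line_setl line_setr line_set_eq _ ij kL).
  by move=> a b ab; apply: leq_trans (line_ge25 ab).
have ln_le a b : h a <= h b -> ln (h a) <= ln (h b).
  by move=> ab; rewrite ler_ln ?posrE ?height_gt0.
have := hC i j k ij kL f (i_min j isT) (j_min k ik).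
rewrite -!/(h _).
have AB := ln_le _ _ (i_min j isT); have BC := ln_le _ _ (j_min k ik).
set A := ln (h i) in AB *; set B := ln (h j) in AB BC *; set D := ln (h k) in BC *.
move=> logdet_le; set L := line_set i j in kL k_min half *.
(* Points off [L] are at least as high as k, those of [L] other than i at least as high as j. *)
have ln_ge l :
    D - (if l \in L then D - B else 0) - (if l == i then B - A else 0) <= ln (h l).
  have [->|li] := eqVneq l i; first by rewrite line_setl -/A; lra.
  have [lL|lL] := boolP (l \in L); rewrite !subr0; last exact/ln_le/k_min.
  by rewrite subKr; apply/ln_le/j_min; rewrite eq_sym.
have : N * D - #|L|%:R * (D - B) - (B - A) <= \sum_l ln (h l).
  apply: (le_trans _ (ler_sum _ (fun l _ => ln_ge l))).
  rewrite !sumrB -!big_mkcond /= big_pred1_eq.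
  by rewrite !sumr_const !mulr_natl.
have halfR : 2 * #|L|%:R <= N by rewrite -natrM ler_nat.
have geR : 25%:R <= #|L|%:R :> R by rewrite ler_nat line_ge25.
rewrite /potential -/h; move: (\sum_l _) => S S_ge.
have N0 : 0 <= N by apply: ler0n.
have h1 := ler_wpM2l N0 logdet_le.
(* The potential plus N C is at least the sum of the products in [h2] and [h3]; [half] makes the
   first coefficient nonnegative. *)
have h2 : 0 <= (2 * N - 3 * #|L|%:R) * (D - B) by apply: mulr_ge0; lra.
have h3 : 0 <= (N - 3) * (B - A) by apply: mulr_ge0; lra.
move: N (#|L|%:R : R) (logdet f) h1 h2 h3 S_ge => n m ld *.
by nra.
Qed.

Lemma exists_near_min (eps : R) : 0 < eps ->
  exists f, forall g, potential P f - eps <= potential P g.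
Proof.
move=> eps0; have [C hC] := potential_bounded.
pose E : set R := [set x | exists f, x = potential P f]%classic.
pose f1 := Frame (qzero R) (qzero R) (qzero R) (fun _ : 'I_3 => ltr01 : 0 < 1 :> R).
have lbE : has_lbound E by exists C => _ [f ->].
have infE : has_inf E by split=> //; exists (potential P f1), f1.
have [_ [f ->] f_lt] := inf_adherent eps0 infE.
exists f => g; rewrite lerBlDr (le_trans (ltW f_lt)) // lerD2r.
by apply: ge_inf => //; exists g.
Qed.

Lemma all_lines_rich_false : False.
Proof.
have N0 : 0 < N by rewrite ltr0n; apply/card_gt0P; exists i0.
have eps0 : 0 < N / 200%:R by rewrite divr_gt0.
have [f f_min] := exists_near_min eps0.
have := energy_le N0 f_min.
(* The value 23/48 is (k^2/2 - k) / (k (k - 1)) at k = 25, the least average of [gram] over distinct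
   pairs of a line. *)
have energy_set (A : {set I}) :
    \sum_(ab | (ab.1 != ab.2) && ((ab.1 \in A) && (ab.2 \in A)))
    (gram P f ab.1 ab.2 - 23%:R / 48%:R) =
  \sum_s (\sum_(a in A) feature P f a s) ^+ 2 - #|A|%:R ^+ 2 * (23%:R / 48%:R)
    - #|A|%:R * (25%:R / 48%:R).
  rewrite sum_offdiag /=.
  under eq_bigr do rewrite sumrB sumr_const.
  rewrite sumrB sum_gram sumr_const.
  under [X in _ - X = _]eq_bigr do rewrite gram_diag.
  rewrite sumr_const -[(1 - _) *+ #|A|]mulr_natr.
  rewrite -[_ *+ #|A| *+ #|A|]mulr_natr -[_ *+ #|A|]mulr_natr.
  by move: (\sum_s _) (#|A|%:R : R) => *; field.
have : 0 <= \sum_(ab | ab.1 != ab.2) (gram P f ab.1 ab.2 - 23%:R / 48%:R).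
  apply: (sum_lines_ge0 line_setl line_setr line_set_eq) => i j ij.
  rewrite energy_set.
  have := line_energy f (ptsub_neq0 (P_neq ij)) (fun a => @line_setP i j a).
  have geR : 25%:R <= #|line_set i j|%:R :> R by rewrite ler_nat line_ge25.
  move: (\sum_s _) (#|line_set i j|%:R : R) geR => E k k25 Ek.
  by nra.
have -> : \sum_(ab | ab.1 != ab.2) (gram P f ab.1 ab.2 - 23%:R / 48%:R) =
    \sum_(ab | (ab.1 != ab.2) && ((ab.1 \in [set: I]) && (ab.2 \in [set: I])))
    (gram P f ab.1 ab.2 - 23%:R / 48%:R).
  by apply: eq_bigl => ab; rewrite !inE !andbT.
rewrite energy_set cardsT.
under eq_bigr do under eq_bigl do rewrite inE.
(* The energy is at least (23/48) n^2 and at most (23/50) n^2, impossible for n > 0. *)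
move: (\sum_s _) N N0 => E n n0 *; nra.
Qed.

End RichLines.

End QuaternionPlane.

(** * Passage from a finite set of points to an indexed family *)

Local Open Scope fset_scope.

Theorem theorem2 (R : realType) (S : {fset pt R}) :
  ~ (exists p v : pt R, v <> ptzero R /\ forall x, x \in S -> on_line p v x) ->
  exists p v : pt R, v <> ptzero R /\
    (2 <= #|` [fset x in S | `[< on_line p v x >]] | <= 24)%N.
Proof.
move=> noncol; apply: contrapT => no_line.
have S_line (p v : pt R) : v <> ptzero R -> exists2 x, x \in S & ~ on_line p v x.
  move=> v0; apply: contrapT => all_on; apply: noncol; exists p, v; split=> // x xS.
  by apply: contrapT => x_off; apply: all_on; exists x.
have v1 : (((1, 0, 0, 0) : quat R), qzero R)%R <> ptzero R.
  by move=> /(congr1 (fun v : pt R => qre v.1)) /eqP; rewrite /qre /= oner_eq0.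
have [x xS _] := S_line (ptzero R) _ v1.
have [y yS xy] := S_line x _ v1.
have xNy : x <> y by move=> e; apply: xy; rewrite -e; apply: on_line_base.
have card_line (i j : S) : #|line_set (val : S -> pt R) i j| =
    #|` [fset x in S | `[< on_line (val i) (ptsub (val j) (val i)) x >]] |.
  rewrite -(card_fsub (fset_sub _ _)); apply: eq_card => k.
  by rewrite !inE /= (valP k).
have neqP (i j : S) : i != j -> val i <> val j by move=> /eqP ij /val_inj.
apply: (@all_lines_rich_false R S val val_inj _ _ [` xS] [` yS]).
(* A line through two points of [S] with fewer than 25 of them would be the line sought. *)
- move=> i j ij; rewrite leqNgt; apply/negP => small; apply: no_line.
  exists (val i), (ptsub (val j) (val i)); split; first exact/ptsub_neq0/neqP.
  rewrite -card_line; apply/andP; split; last exact: small.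
  by rewrite (cardsD1 i) (cardsD1 j) line_setl in_setD1 eq_sym ij line_setr.
- move=> i j ij; have [z zS z_off] := S_line (val i) _ (ptsub_neq0 (neqP _ _ ij)).
  by exists [` zS]; apply/line_setP.
- by apply/eqP => /(congr1 val).
Qed.
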